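(* Let $\mathcal{H}$ be a separable real Hilbert space, let $A\colon \mathcal{H}\rightrightarrows\mathcal{H}$ be maximally monotone, and let $B\colon \mathcal{H}\to\mathcal{H}$ be monotone with $B=\frac{1}{n}\sum_{i=1}^nB_i$ for $L$-Lipschitz continuous operators $B_i\colon\mathcal{H}\to\mathcal{H}$, $i=1,\dots,n$. Suppose that $(A+B)^{-1}(0)\neq\varnothing$ and that $\lambda\in\left(0,\frac{1}{2L}\right)$. Given $x_0,x_{-1}\in\mathcal{H}$, define the sequence $(x_k)$ by: for each $k\in\mathbb{N}$, choose $i_k$ uniformly at random from $\{1,\dots,n\}$ (independently of the past) and set $$x_{k+1} = J_{\lambda A}\bigl( x_k-\lambda B(x_k) - \lambda( B_{i_k}(x_k) - B_{i_k}(x_{k-1})) \bigr).$$ Then $(x_k)$ converges weakly almost surely to a $(A+B)^{-1}(0)$-valued random variable.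
   Context: $J_{\lambda A}:=(I+\lambda A)^{-1}$ is the resolvent of $\lambda A$. *)

(* Defs.v *)
From HB Require Import structures.
From mathcomp Require Import all_boot all_order all_algebra.
From mathcomp Require Import all_classical all_reals all_analysis.
Set Implicit Arguments. Unset Strict Implicit. Unset Printing Implicit Defensive.
Import Order.TTheory GRing.Theory Num.Theory.
Import numFieldNormedType.Exports.
Local Open Scope classical_set_scope.
Local Open Scope ring_scope.

Section Hilbert.
Variables (R : realType) (H : normedModType R).

Definition is_inner_product (ip : H -> H -> R) : Prop :=
  [/\ (forall x y, ip x y = ip y x),
      (forall (a : R) (x y z : H), ip (a *: x + y) z = a * ip x z + ip y z) &
      (forall x, ip x x = `|x| ^+ 2)].

Definition separable_space : Prop :=
  exists D : set H, countable D /\ closure D = setT.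

Variable ip : H -> H -> R.

Definition monotone_op (A : H -> set H) : Prop :=
  forall x y u v, A x u -> A y v -> 0 <= ip (x - y) (u - v).

Definition maximally_monotone (A : H -> set H) : Prop :=
  monotone_op A /\
  forall A' : H -> set H, monotone_op A' ->
    (forall x u, A x u -> A' x u) -> forall x u, A' x u -> A x u.

Definition monotone_fun (B : H -> H) : Prop :=
  forall x y, 0 <= ip (x - y) (B x - B y).

Definition lipschitz_with (L : R) (f : H -> H) : Prop :=
  forall x y, `|f x - f y| <= L * `|x - y|.

(* resolvent J_{lam A} = (I + lam A)^{-1}: J z is the (for maximally
   monotone A, unique) p with z \in p + lam A p *)
Definition resolvent (A : H -> set H) (lam : R) (z : H) : H :=
  xget z [set p | exists a, A p a /\ z = p + lam *: a].

Definition zeros_sum (A : H -> set H) (B : H -> H) : set H :=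
  [set z | A z (- B z)].

Definition weak_cvg (u : nat -> H) (l : H) : Prop :=
  forall y, (fun k => ip (u k) y) @ \oo --> ip l y.

End Hilbert.

Definition borel_measurable_map d (Omega : measurableType d)
  (R : realType) (H : normedModType R) (f : Omega -> H) : Prop :=
  forall U : set H, open U -> measurable (f @^-1` U).

(* Main.v *)
(* Since each draw is uniform on a finite set, the iterates live on an n-ary tree
   (the histories of draws), and conditional expectation is the average over the n
   children of a node. Write x for the current and x' for the previous iterate. For
   every zero z of A + B, the function
     V_z = |x - z|^2 + 2 lam <x - z, B x' - B x> + |x - x'|^2 / 2
   dominates |x - z|^2 / 2 because lam L < 1/2, and its average over the children
   is at most V_z - (1/2 - lam L) |x - x'|^2. By Ville's inequality a nonnegative
   supermartingale is almost surely bounded; applied to V_z plus the accumulated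
   decrease this gives x - x' -> 0, and applied to the capital of a gambler who buys
   V_z low and sells it high it gives the convergence of V_z, hence of |x - z|,
   simultaneously for a countable dense set of zeros z. Opial's argument, with weak
   cluster points taken along ultrafilters, then yields weak convergence.
   The resolvent is everywhere defined by Minty's theorem, obtained by minimising
   the Fitzpatrick function plus half the squared norm. *)
Require Import Defs.
From HB Require Import structures.
From mathcomp Require Import all_boot all_order all_algebra.
From mathcomp Require Import all_classical all_reals all_analysis.
From mathcomp Require Import zify ring lra.
From mathcomp Require Import measurable_realfun.
Set Implicit Arguments. Unset Strict Implicit. Unset Printing Implicit Defensive.
Import Order.TTheory GRing.Theory Num.Theory.
Import numFieldNormedType.Exports.
Local Open Scope classical_set_scope.
Local Open Scope ring_scope.

(** * Hilbert space geometry *)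

Section InnerProduct.
Variables (R : realType) (H : normedModType R) (ip : H -> H -> R).
Hypothesis hip : is_inner_product ip.

Lemma ipC x y : ip x y = ip y x.
Proof. by case: hip. Qed.

Lemma ipxx x : ip x x = `|x| ^+ 2.
Proof. by case: hip. Qed.

Lemma ipDl x y z : ip (x + y) z = ip x z + ip y z.
Proof. by case: hip => _ /(_ 1 x y z); rewrite scale1r mul1r. Qed.

Lemma ip0l z : ip 0 z = 0.
Proof. by have := ipDl 0 0 z; rewrite addr0; lra. Qed.

Lemma ipZl a x z : ip (a *: x) z = a * ip x z.
Proof. by case: hip => _ /(_ a x 0 z); rewrite addr0 ip0l addr0. Qed.

Lemma ipNl x z : ip (- x) z = - ip x z.
Proof. by rewrite -scaleN1r ipZl mulN1r. Qed.

Lemma ipDr x y z : ip z (x + y) = ip z x + ip z y.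
Proof. by rewrite ipC ipDl !(ipC z). Qed.

Lemma ip0r z : ip z 0 = 0.
Proof. by rewrite ipC ip0l. Qed.

Lemma ipZr a x z : ip z (a *: x) = a * ip z x.
Proof. by rewrite ipC ipZl (ipC z). Qed.

Lemma ipNr x z : ip z (- x) = - ip z x.
Proof. by rewrite ipC ipNl (ipC z). Qed.

Definition ipE := (ipDl, ipDr, ipZl, ipZr, ipNl, ipNr, ip0l, ip0r).

Lemma ip_ge0 x : 0 <= ip x x.
Proof. by rewrite ipxx exprn_ge0. Qed.

Lemma ip_eq0 x : ip x x = 0 -> x = 0.
Proof. by rewrite ipxx => /eqP; rewrite sqrf_eq0 normr_eq0 => /eqP. Qed.

(** Cauchy-Schwarz: expand the square of [|y| x - |x| y] and divide by [2 |x| |y|]. *)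
Lemma ip_le x y : ip x y <= `|x| * `|y|.
Proof.
have [->|x0] := eqVneq x 0; first by rewrite ip0l normr0 mul0r.
have [->|y0] := eqVneq y 0; first by rewrite ip0r normr0 mulr0.
have nx : 0 < `|x| by rewrite normr_gt0.
have ny : 0 < `|y| by rewrite normr_gt0.
have := ip_ge0 (`|y| *: x - `|x| *: y).
rewrite !ipE (ipC y x) !ipxx => h.
have : 0 <= (`|x| * `|y|) * (`|x| * `|y| - ip x y) by lra.
by rewrite pmulr_rge0 ?mulr_gt0 // subr_ge0.
Qed.

Lemma normr_ip_le x y : `|ip x y| <= `|x| * `|y|.
Proof.
by rewrite ler_norml ip_le andbT lerNl -ipNr (le_trans (ip_le _ _)) ?normrN.
Qed.

Lemma ip_polar x y : ip x y = 4^-1 * (`|x + y| ^+ 2 - `|x - y| ^+ 2).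
Proof. by rewrite -!ipxx !ipE (ipC y x); field. Qed.

(** Polarisation reduces this to continuity of the norm. *)
Lemma cvg_ip T (F : set_system T) {FF : Filter F} (f g : T -> H) (a b : H) :
  f @ F --> a -> g @ F --> b -> (fun t => ip (f t) (g t)) @ F --> ip a b.
Proof.
move=> fa gb; rewrite ip_polar !expr2.
under eq_fun do rewrite ip_polar !expr2.
apply: cvgM; first exact: cvg_cst.
by apply: cvgB; apply: cvgM; apply: cvg_norm; by [apply: cvgD|apply: cvgB].
Qed.

End InnerProduct.

(** * Strongly convex minimisation in a complete space *)

Section Complete.
Variables (R : realType) (H : completeNormedModType R) (ip : H -> H -> R).
Hypothesis hip : is_inner_product ip.

(** Cauchy criterion, in the shape supplied by a minimising sequence with gaps [1/(k+1)]. *)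
Lemma cvg_of_harmonic_bound (xs : nat -> H) (c : R) :
  (forall k l, `|xs k - xs l| ^+ 2 <= c * (k.+1%:R^-1 + l.+1%:R^-1)) ->
  cvg (xs @ \oo).
Proof.
move=> hx; apply/cauchy_cvgP/cauchy_exP => e e0.
have c1 : 0 < `|c| + 1 by apply: ltr_wpDl.
have e1 : 0 < e ^+ 2 / (2 * (`|c| + 1)) by rewrite divr_gt0 ?exprn_gt0 ?mulr_gt0.
have [k _ hk] := near_infty_natSinv_lt (PosNum e1).
exists (xs k); exists k => // l /= kl; rewrite -ball_normE /=.
rewrite -(@ltr_pXn2r _ 2) ?nnegrE ?(ltW e0) //.
apply: le_lt_trans (hx k l) _.
have := hk k (leqnn k); have := hk l kl; rewrite /= => a b.
have h : c * (k.+1%:R^-1 + l.+1%:R^-1) <=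
    (`|c| + 1) * (k.+1%:R^-1 + l.+1%:R^-1).
  rewrite ler_wpM2r ?addr_ge0 ?invr_ge0 //.
  by rewrite (le_trans (ler_norm _)) // lerDl.
apply: le_lt_trans h _; rewrite -ltr_pdivlMl //.
have -> : (`|c| + 1)^-1 * e ^+ 2 = 
  e ^+ 2 / (2 * (`|c| + 1)) + e ^+ 2 / (2 * (`|c| + 1)).
  by field; rewrite lt0r_neq0.
exact: ltrD.
Qed.

(* The set [S] is the epigraph of a function of the pair [(x, u)]; the last term
   of the midpoint condition is what strong convexity provides. *)
Lemma strongly_convex_min (S : H -> H -> R -> Prop) (b : R) :
  (exists x u t, S x u t) ->
  (forall x u t, S x u t -> b <= t) ->
  (forall x u t x' u' t', S x u t -> S x' u' t' ->
     S (2^-1 *: (x + x')) (2^-1 *: (u + u'))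
       ((t + t') / 2 - (`|x - x'| ^+ 2 + `|u - u'| ^+ 2) / 8)) ->
  (forall (xs us : nat -> H) (ts : nat -> R) x u t,
     (forall k, S (xs k) (us k) (ts k)) ->
     xs @ \oo --> x -> us @ \oo --> u -> ts @ \oo --> t -> S x u t) ->
  exists x u m, S x u m /\ forall x' u' t', S x' u' t' -> m <= t'.
Proof.
move=> [x0 [u0 [t0 S0]]] Sb Smid Scl.
pose T := [set t | exists x u, S x u t].
have T0 : T !=set0 by exists t0, x0, u0.
have Tlb : lbound T b by move=> t [x [u /Sb]].
have hT : has_lbound T by exists b.
set m := inf T.
have mT t : T t -> m <= t by move=> Tt; apply: ge_inf.
have /choice[f Sf] k : exists p : H * H * R,
    S p.1.1 p.1.2 p.2 /\ p.2 < m + k.+1%:R^-1.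
  have [|t [x [u Sxut]] lt_t] := @inf_adherent R T k.+1%:R^-1 _ (conj T0 hT).
    by rewrite invr_gt0.
  by exists (x, u, t).
pose xs k := (f k).1.1; pose us k := (f k).1.2; pose ts k := (f k).2.
(* The midpoint value is at least [m] and [ts k], [ts l] exceed [m] by less than their gaps, so the
   convexity term, with its factor 1/8, is at most half the sum of the gaps. *)
have bnd k l : `|xs k - xs l| ^+ 2 + `|us k - us l| ^+ 2 <=
    4 * (k.+1%:R^-1 + l.+1%:R^-1).
  have [Sk tk] := Sf k; have [Sl tl] := Sf l.
  have := mT _ (ex_intro _ _ (ex_intro _ _ (Smid _ _ _ _ _ _ Sk Sl))).
  rewrite /xs /us; move: tk tl.
  by move: (k.+1%:R^-1) (l.+1%:R^-1) => a c; lra.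
have /cvg_ex[x xsx] : cvg (xs @ \oo).
  apply: (@cvg_of_harmonic_bound _ 4) => k l; apply: le_trans (bnd k l).
  by rewrite lerDl exprn_ge0.
have /cvg_ex[u usu] : cvg (us @ \oo).
  apply: (@cvg_of_harmonic_bound _ 4) => k l; apply: le_trans (bnd k l).
  by rewrite lerDr exprn_ge0.
have tsm : ts @ \oo --> m.
  apply: (@squeeze_cvgr _ _ _ _ (cst m) (fun k => m + k.+1%:R^-1)).
  - by apply: nearW => k; have [Sk /ltW ->] := Sf k; rewrite andbT mT //;
      exists (xs k), (us k).
  - exact: cvg_cst.
  - by rewrite -[X in _ --> X]addr0; apply: cvgD; [exact: cvg_cst|exact: cvg_harmonic].
exists x, u, m; split; last by move=> x' u' t' S'; apply: mT; exists x', u'.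
by apply: (Scl xs us ts) => // k; have [] := Sf k.
Qed.

(** First-order condition at a minimum: divide by [s] and let [s] tend to 0. *)
Lemma le0_linear_quadratic (a c : R) :
  (forall s, 0 < s -> s <= 1 -> 0 <= s * a + s ^+ 2 * c) -> 0 <= a.
Proof.
move=> h; rewrite leNgt; apply/negP => a0.
(* Chosen so that [s |c| < - a / 2], hence [a + s c < 0]. *)
pose s := Num.min 1 (- a / (2 * (`|c| + 1))).
have c1 : 0 < `|c| + 1 by apply: ltr_wpDl.
have s0 : 0 < s by rewrite lt_min ltr01 divr_gt0 ?oppr_gt0 ?mulr_gt0.
have s1 : s <= 1 by rewrite ge_min lexx.
have s2 : s * (2 * (`|c| + 1)) <= - a.
  by rewrite -ler_pdivlMr ?mulr_gt0 // ge_min lexx orbT.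
have := h _ s0 s1; rewrite expr2 -mulrA -mulrDr pmulr_rge0 //.
have : s * c <= s * `|c| by rewrite ler_pM2l // ler_norm.
have : 0 <= s * `|c| by rewrite mulr_ge0 // ltW.
by nra.
Qed.

End Complete.

(** * Maximally monotone operators and weak limits *)

Section Minty.
Variables (R : realType) (H : completeNormedModType R) (ip : H -> H -> R).
Hypothesis hip : is_inner_product ip.

(* The minimiser [(x, u)] of [F(x, u) + |x|^2/2 + |u|^2/2], where [F] is the
   Fitzpatrick function of [A], satisfies [-x \in A (-u)] and [u = -x]. *)
Lemma minty_zero (A : H -> set H) :
  monotone_op ip A ->
  (forall x u, (forall y v, A y v -> 0 <= ip (x - y) (u - v)) -> A x u) ->
  exists x, A x (- x).
Proof.
move=> Amon Amax.
pose F (x u : H) (t : R) := forall y v, A y v -> ip y u + ip x v - ip y v <= t.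
(* If [t < ip x u], then [(x, u)] is monotonically related to [A], hence in its graph, and testing
   [F] there gives [ip x u <= t]. *)
have F_ge x u t : F x u t -> ip x u <= t.
  move=> Ft; rewrite leNgt; apply/negP => lt_t.
  have Axu : A x u.
    apply: Amax => y v Ayv; have := Ft y v Ayv; rewrite !(ipE hip).
    by lra.
  by have := Ft x u Axu; rewrite addrK; lra.
have FA y v : A y v -> F y v (ip y v).
  move=> Ayv y' v' A'; have := Amon _ _ _ _ Ayv A'; rewrite !(ipE hip).
  by lra.
pose q x u := 2^-1 * (ip x x + ip u u).
pose S x u t := F x u (t - q x u).
have [||||xh [uh [m [Sm mmin]]]] := @strongly_convex_min R H S 0.
- have [y [v Ayv]] : exists y v, A y v.
    apply: contrapT => none; apply: (none); exists 0, 0.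
    by apply: Amax => y v Ayv; case: none; exists y, v.
  exists y, v, (ip y v + q y v); rewrite /S addrK; exact: FA.
(* [F + q] is at least [ip x u + q x u = |x + u|^2 / 2]. *)
- move=> x u t /F_ge; have := ip_ge0 hip (x + u).
  by rewrite /q !(ipE hip) (ipC hip u x); lra.
- move=> x u t x' u' t' S1 S2 y v Ayv.
  have := S1 _ _ Ayv; have := S2 _ _ Ayv.
  rewrite /q -!(ipxx hip) !(ipE hip) (ipC hip x' x) (ipC hip u' u); lra.
- move=> xs us ts x u t Sk xsx usu tst y v Ayv.
  have h1 : (fun k => ip y (us k) + ip (xs k) v - ip y v) @ \oo -->
      ip y u + ip x v - ip y v.
    apply: cvgB; last exact: cvg_cst.
    by apply: cvgD; [exact: (cvg_ip hip (cvg_cst _) usu)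
                   |exact: (cvg_ip hip xsx (cvg_cst _))].
  have h2 : (fun k => ts k - q (xs k) (us k)) @ \oo --> t - q x u.
    apply: cvgB => //; apply: cvgM; first exact: cvg_cst.
    by apply: cvgD; [exact: (cvg_ip hip xsx xsx)|exact: (cvg_ip hip usu usu)].
  by apply: (ler_cvg_to h1 h2); apply: nearW => k; exact: Sk.
have Fm := F_ge _ _ _ Sm.
(* First-order optimality along the segment from the minimiser to a graph point, combined with
   [ip xh uh <= m - q xh uh]. *)
have key y v : A y v -> `|xh + uh| ^+ 2 <= ip (y + uh) (v + xh).
  move=> Ayv.
  suff : 0 <= - (m - q xh uh) + ip y v + ip xh (y - xh) + ip uh (v - uh).
    rewrite -(ipxx hip) !(ipE hip) (ipC hip uh xh) (ipC hip y xh); lra.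
  apply: (@le0_linear_quadratic _ _ (q (y - xh) (v - uh))) => s s0 s1.
  have /mmin : S (xh + s *: (y - xh)) (uh + s *: (v - uh))
    ((1 - s) * (m - q xh uh) + s * ip y v +
      q (xh + s *: (y - xh)) (uh + s *: (v - uh))).
    rewrite /S addrK => y' v' A'.
    have := Sm _ _ A'; have := FA _ _ Ayv _ _ A'.
    rewrite !(ipE hip) => h1 h2.
    have := ler_wpM2l (ltW s0) h1.
    have : 0 <= 1 - s by lra.
    by move=> /ler_wpM2l /(_ _ _ h2); lra.
  by rewrite /q !(ipE hip) (ipC hip y xh) (ipC hip v uh); lra.
(* By [key], this pair is monotonically related to [A]; evaluating [key] at the pair itself then
   forces [xh + uh = 0]. *)
have Aux : A (- uh) (- xh).
  apply: Amax => y v /key h; have := exprn_ge0 2 (normr_ge0 (xh + uh)).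
  by move=> /le_trans/(_ h); rewrite -!opprD !(ipE hip); lra.
have := key _ _ Aux; rewrite !addNr (ip0l hip) => h.
have /eqP : `|xh + uh| ^+ 2 = 0 by apply/eqP; rewrite eq_le h exprn_ge0.
rewrite sqrf_eq0 normr_eq0 addr_eq0 => /eqP xu.
by exists xh; rewrite {1}xu.
Qed.

(** Adding a monotonically related pair to the graph keeps it monotone. *)
Lemma maximally_monotone_rel (A : H -> set H) : maximally_monotone ip A ->
  forall x u, (forall y v, A y v -> 0 <= ip (x - y) (u - v)) -> A x u.
Proof.
move=> [Amon Amax] x u h.
apply: (Amax (fun y v => A y v \/ (y = x /\ v = u))); [|by left|by right].
move=> y y' v v' [Ay|[-> ->]] [Ay'|[-> ->]].
- exact: Amon.
- by have := h _ _ Ay; rewrite !(ipE hip); lra.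
- exact: h.
- by rewrite !subrr (ip0l hip).
Qed.

(** Minty's theorem: [z] lies in [x + lam A x] exactly when [- x] is a value at [x] of [lam A - z],
    a relation to which [minty_zero] applies. The default of [xget] is then never taken. *)
Lemma resolvent_spec (A : H -> set H) (lam : R) (z : H) :
  maximally_monotone ip A -> 0 < lam ->
  exists a, A (resolvent A lam z) a /\ z = resolvent A lam z + lam *: a.
Proof.
move=> Am lam0; rewrite /resolvent.
have lamN0 : lam != 0 by rewrite gt_eqF.
have lamV0 : 0 < lam^-1 by rewrite invr_gt0.
apply: (xgetPex z (P := [set p | exists a, A p a /\ z = p + lam *: a])).
have [||x Ax] := @minty_zero (fun x w => A x (lam^-1 *: (w + z))).
- move=> x y u v Au Av; have := (proj1 Am) _ _ _ _ Au Av.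
  by rewrite -scalerBr opprD addrACA subrr addr0 (ipZr hip) pmulr_rge0.
- move=> x u h; apply: (maximally_monotone_rel Am) => y v Ayv.
  have := h y (lam *: v - z); rewrite subrK scalerA mulVf // scale1r => /(_ Ayv).
  have -> : lam^-1 *: (u + z) - v = lam^-1 *: (u - (lam *: v - z)).
    rewrite opprB addrA scalerBr scalerA mulVf // scale1r.
    by rewrite scalerDr.
  by rewrite (ipZr hip) pmulr_rge0.
exists x, (lam^-1 *: (- x + z)); split => //.
by rewrite scalerA mulfV // scale1r addrA subrr add0r.
Qed.

(* Minty's trick: the resolvent [y] of [x - lam B x] gives
   [0 <= (L - 1/lam) |x - y|^2], so that [x = y]. *)
Lemma zero_of_monotone_relation (A : H -> set H) (B : H -> H) (L : R) (x : H) :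
  maximally_monotone ip A -> 0 < L -> lipschitz_with L B ->
  (forall y v, A y v -> 0 <= ip (x - y) (- B y - v)) -> A x (- B x).
Proof.
move=> Am L0 BL h.
(* Any value with [lam * L < 1] makes the coefficient of [|x - y|^2] negative. *)
pose lam := (2 * L)^-1.
have lam0 : 0 < lam by rewrite invr_gt0 mulr_gt0.
have lamL : lam * L = 2^-1 by rewrite /lam; field; rewrite gt_eqF.
have [a [Aa ea]] := resolvent_spec (x - lam *: B x) Am lam0.
set y := resolvent _ _ _ in Aa ea.
have ela : lam *: a = x - y - lam *: B x.
  by rewrite [RHS]addrAC ea addrAC subrr add0r.
have hy : 0 <= ip (x - y) (lam *: (- B y - a)).
  by rewrite (ipZr hip) mulr_ge0 ?h // ltW.
have e1 : lam *: (- B y - a) = lam *: (B x - B y) - (x - y).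
  by rewrite scalerBr ela scalerBr scalerN opprB addrCA addrA.
have b1 : ip (x - y) (B x - B y) <= L * `|x - y| ^+ 2.
  apply: le_trans (ip_le hip _ _) _; rewrite expr2 mulrCA ler_wpM2l //.
have : `|x - y| ^+ 2 = 0.
  apply/eqP; rewrite eq_le exprn_ge0 // andbT.
  move: hy; rewrite e1 (ipDr hip) (ipZr hip) (ipNr hip) (ipxx hip) => hy.
  have := ler_wpM2l (ltW lam0) b1; rewrite mulrA lamL; lra.
move/eqP; rewrite sqrf_eq0 normr_eq0 => /eqP xy.
have -> : - B x = a.
  apply: (scalerI (lt0r_neq0 lam0)).
  by rewrite ela xy sub0r scalerN.
by rewrite (subr0_eq xy).
Qed.

End Minty.

(** * Weak limits along ultrafilters *)

Section WeakLimit.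
Variables (R : realType) (H : completeNormedModType R) (ip : H -> H -> R).
Hypothesis hip : is_inner_product ip.

Lemma ultra_fmap T S (f : T -> S) (U : set_system T) :
  UltraFilter U -> UltraFilter (f @ U).
Proof.
move=> UU; apply: Build_UltraFilter => G GF UG.
apply/seteqP; split=> [B GB|B]; last exact: UG.
have [//|UB] := in_ultra_setVsetC (f @^-1` B) UU.
have /(filterI GB) : G (~` B) by apply: UG.
by rewrite setICr => /filter_not_empty.
Qed.

Lemma bounded_ultra_cvg T (U : set_system T) (f : T -> R) (c : R) :
  UltraFilter U -> (forall t, `|f t| <= c) -> exists a : R, f @ U --> a.
Proof.
move=> UU fc; have := @segment_compact R (- c) c; rewrite compact_ultra /= => cpt.
have [|a [_ fa]] := cpt _ (ultra_fmap f UU); last by exists a.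
apply: (@filterS _ U _ setT) filterT => t _.
by rewrite /= in_itv /= -ler_norml.
Qed.

(* The limit of [ip (x k) y] along [U] is a bounded linear form in [y], which is
   represented by the minimiser of [|y|^2 - 2 l(y)]. *)
Lemma bounded_weak_ultra_cvg (U : set_system nat) (x : nat -> H) (M : R) :
  UltraFilter U -> (forall k, `|x k| <= M) ->
  exists a, forall y, (fun k => ip (x k) y) @ U --> ip a y.
Proof.
move=> UU xM.
have M0 : 0 <= M by apply: le_trans (xM 0).
have bd y k : `|ip (x k) y| <= M * `|y|.
  by rewrite (le_trans (normr_ip_le hip _ _)) // ler_wpM2r.
have /choice[l lP] y : exists a : R, (fun k => ip (x k) y) @ U --> a.
  exact: bounded_ultra_cvg (bd y).
have lim_eq (f : nat -> R) (a b : R) : f @ U --> a -> f @ U --> b -> a = b.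
  by move=> fa fb; exact: (cvg_unique (@Rhausdorff R) fa fb).
have lD y z : l (y + z) = l y + l z.
  apply: lim_eq (lP _) _; under eq_fun do rewrite (ipDr hip).
  exact: cvgD.
have lZ s y : l (s *: y) = s * l y.
  apply: lim_eq (lP _) _; under eq_fun do rewrite (ipZr hip).
  by apply: cvgM => //; exact: cvg_cst.
have lN y : l (- y) = - l y by rewrite -scaleN1r lZ mulN1r.
have lM y : l y <= M * `|y|.
  apply: (cvgr_to_le (lP y)); apply: nearW => k.
  exact: le_trans (ler_norm _) (bd y k).
(* [strongly_convex_min] works with pairs; the second entry enters only through its own square. *)
pose S (y u : H) (t : R) := ip y y + ip u u - 2 * l y <= t.
have [||||a [u [m [Sm mmin]]]] := @strongly_convex_min R H S (- M ^+ 2).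
- by exists 0, 0, (ip 0 0 + ip 0 0 - 2 * l 0); rewrite /S.
- move=> y u t; apply: le_trans; have := lM y; have := ip_ge0 hip u.
  by have := sqr_ge0 (M - `|y|); rewrite (ipxx hip y); lra.
- move=> y u t y' u' t'; rewrite /S -!(ipxx hip) !(ipE hip) lZ lD.
  rewrite (ipC hip y' y) (ipC hip u' u).
  have := ip_ge0 hip (y - y'); have := ip_ge0 hip (u - u').
  by rewrite !(ipE hip) (ipC hip y' y) (ipC hip u' u); lra.
- move=> ys us ts y u t Sk ysy usu tst.
  have lys : (fun k => l (ys k)) @ \oo --> l y.
    apply/subr_cvg0/norm_cvg0P.
    apply: (@squeeze_cvgr _ _ _ _ (cst 0) (fun k => M * `|ys k - y|)).
    + apply: nearW => k; rewrite normr_ge0 -lN -lD /= ler_norml lM andbT.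
      by rewrite lerNl -lN (le_trans (lM _)) // normrN.
    + exact: cvg_cst.
    + rewrite -[X in _ --> X](mulr0 M); apply: cvgM; first exact: cvg_cst.
      rewrite -(@normr0 _ H) -(subrr y); apply: cvg_norm.
      by apply: cvgB => //; exact: cvg_cst.
  have h : (fun k => ip (ys k) (ys k) + ip (us k) (us k) - 2 * l (ys k)) @ \oo
      --> ip y y + ip u u - 2 * l y.
    apply: cvgB; last by apply: cvgM => //; exact: cvg_cst.
    by apply: cvgD; [exact: (cvg_ip hip ysy ysy)|exact: (cvg_ip hip usu usu)].
  by apply: (ler_cvg_to h tst); apply: nearW => k; exact: Sk.
(* Optimality along [a + s y] gives one inequality; replacing [y] by [- y] gives the other. *)
have key y : l y <= ip a y.
  rewrite -subr_ge0 -(@pmulr_rge0 _ 2) //.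
  apply: (@le0_linear_quadratic _ _ (ip y y)) => s _ _.
  have /mmin : S (a + s *: y) u (ip (a + s *: y) (a + s *: y) + ip u u
    - 2 * l (a + s *: y)) by rewrite /S.
  by move: Sm; rewrite /S lD lZ !(ipE hip) (ipC hip y a); lra.
exists a => y; suff <- : l y = ip a y by [].
apply/eqP; rewrite eq_le key /= -lerN2 -lN -(ipNr hip) key //.
Qed.

End WeakLimit.

(** * Supermartingales on the tree of histories *)

(** The supremum of [S] is the lower limit. If the sequence kept exceeding it by [e], it would cross
    two rational levels in between infinitely often. *)
Lemma cvg_of_no_oscillation (R : realType) (v : nat -> R) (M : R) :
  (forall k, 0 <= v k) -> (forall k, v k <= M) ->
  (forall p q : rat, 0 < ratr p :> R -> ratr p < ratr q :> R ->
    (forall k, exists2 l, (k <= l)%N & v l <= ratr p) ->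
    (forall k, exists2 l, (k <= l)%N & ratr q <= v l) -> False) ->
  exists l : R, v @ \oo --> l.
Proof.
move=> v0 vM osc.
pose S := [set c : R | exists K, forall k, (K <= k)%N -> c <= v k].
have S0 : S 0 by exists 0%N => k _; exact: v0.
have hS : has_sup S.
  split; first by exists 0.
  by exists M => c [K h]; apply: le_trans (vM K); exact: h.
exists (sup S); apply/cvgrPdist_lt => e e0.
have l0 : 0 <= sup S by apply: ub_le_sup => //; case: hS.
have [c [K1 h1] lc] := sup_adherent e0 hS.
have e3 : 0 < e / 3 by rewrite divr_gt0.
have [p] : exists p, ratr p \in `](sup S + e / 3), (sup S + 2 * (e / 3))[.
  by apply: rat_in_itvoo; lra.
rewrite in_itv /= => /andP[p1 p2].
have [q] : exists q, ratr q \in `](sup S + 2 * (e / 3)), (sup S + e)[.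
  by apply: rat_in_itvoo; lra.
rewrite in_itv /= => /andP[q1 q2].
have low k : exists2 l, (k <= l)%N & v l <= ratr p.
  apply: contrapT => none.
  suff /(ub_le_sup (proj2 hS)) : S (ratr p) by lra.
  exists k => l kl; rewrite leNgt; apply/negP => lt; apply: none.
  by exists l => //; exact: ltW.
have [K2 h2] : exists K, forall k, (K <= k)%N -> v k < ratr q.
  apply: contrapT => none; apply: (osc p q) => //; [lra|lra|] => k.
  apply: contrapT => no_k; apply: none; exists k => l kl.
  by rewrite ltNge; apply/negP => lt; apply: no_k; exists l.
exists (maxn K1 K2) => // k /=; rewrite geq_max => /andP[k1 k2].
by have := h1 k k1; have := h2 k k2; rewrite ltr_distl => *; apply/andP; split; lra.
Qed.

Section HistoryTree.
Context (R : realType) (d : measure_display) (Omega : measurableType d)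
  (P : probability Omega R) (n : nat) (i : nat -> Omega -> 'I_n).
Hypothesis n_gt0 : (0 < n)%N.
Hypothesis meas_i : forall k (a : 'I_n), measurable [set w | i k w = a].
Hypothesis unif_i : forall k (a : 'I_k -> 'I_n),
  P [set w | forall j : 'I_k, i j w = a j] = ((n%:R ^- k : R)%:E).

(* Latest draw first, so that extending a history is [cons]. *)
Fixpoint history (k : nat) (w : Omega) : seq 'I_n :=
  if k is k'.+1 then i k' w :: history k' w else [::].

Lemma size_history k w : size (history k w) = k.
Proof. by elim: k => //= k ->. Qed.

Lemma nth_history a0 k w m : (m < k)%N -> nth a0 (history k w) m = i (k - m.+1) w.
Proof.
elim: k m => // k IH [|m] /= mk; first by rewrite subSS subn0.
by rewrite IH // subSS.
Qed.

(** Histories take countably many values, so every set of them pulls back to an event. *)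
Lemma measurable_history k (S : set (seq 'I_n)) :
  measurable [set w | S (history k w)].
Proof.
have meas1 s : measurable [set w | history k w = s].
  elim: k s => [|k IH] [|a s] /=.
  - by rewrite (_ : [set w | _] = setT)//; apply/seteqP; split.
  - by rewrite (_ : [set w | _] = set0)//; apply/seteqP; split.
  - by rewrite (_ : [set w | _] = set0)//; apply/seteqP; split.
  - rewrite (_ : [set w | _] = [set w | i k w = a] `&` [set w | history k w = s]).
      exact: measurableI.
    by apply/seteqP; split => w /= [-> ->].
rewrite (_ : [set w | _] =
    \bigcup_s (if s \in S then [set w | history k w = s] else set0)).
  by apply: countable_bigcupT_measurable => // s; case: ifP.
apply/seteqP; split=> w /=.
  by move=> Sw; exists (history k w) => //; rewrite mem_set.
by move=> [s _]; case: ifP => // /set_mem sS /= ->.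
Qed.

Lemma prob_history s : P [set w | history (size s) w = s] = (n%:R ^- size s : R)%:E.
Proof.
pose a0 := Ordinal n_gt0.
(* [history] stores the latest draw first, so draw [j] sits at position [size s - j.+1]. *)
rewrite -(unif_i (fun j : 'I_(size s) => nth a0 s (size s - j.+1))).
congr (P _); apply/seteqP; split=> w /=.
  move=> ws j; rewrite -{2}ws nth_history; first last.
    by case: j => j /= js; rewrite subnSK // leq_subr.
  by congr (i _ w); case: j => j /= js; rewrite subnSK // subKn // ltnW.
move=> h; apply: (@eq_from_nth _ a0); rewrite size_history // => m ms.
rewrite nth_history //.
have lt_m : (size s - m.+1 < size s)%N by rewrite subnSK // leq_subr.
by rewrite (h (Ordinal lt_m)) /= subnSK // subKn // ltnW.
Qed.

(** The conditional expectation inequality given the history [s], multiplied through by [n]. *)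
Definition tree_supermartingale (U : seq 'I_n -> R) :=
  forall s, \sum_(a < n) U (a :: s) <= n%:R * U s.

Lemma prob_sub (S T : set Omega) :
  measurable S -> measurable T -> S `<=` T -> (P S <= P T)%E.
Proof. by move=> mS mT; apply: le_measure; rewrite inE. Qed.

(** Stated at an arbitrary node because the induction on the horizon [N] splits the event over the
    children of [s]. *)
Lemma ville_finite (U : seq 'I_n -> R) (c : R) (N : nat) s :
  (forall s, 0 <= U s) -> tree_supermartingale U -> 0 < c ->
  (P [set w | history (size s) w = s /\
       exists2 j, (j <= N)%N & (c <= U (history (size s + j) w))%R] <=
    (n%:R ^- size s * U s / c)%:E)%E.
Proof.
move=> U0 Usup c0.
pose E N s := [set w | history (size s) w = s /\
       exists2 j, (j <= N)%N & (c <= U (history (size s + j) w))%R].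
have mE N' s' : measurable (E N' s').
  have -> : E N' s' = [set w | [set s'] (history (size s') w)] `&`
      \bigcup_(j in [set j | (j <= N')%N])
        [set w | [set t | c <= U t] (history (size s' + j) w)].
    by apply/seteqP; split => w /= [ws] [j jN cj]; split => //; exists j.
  apply: measurableI; first exact: measurable_history.
  by apply: bigcup_measurable => j _; exact: measurable_history.
rewrite -/(E N s); elim: N s => [|N IH] s.
(* If [U s] already reaches [c], the bound is at least the probability of the node itself. *)
all: have [cU|Uc] := leP c (U s).
- apply: (@le_trans _ _ (P [set w | history (size s) w = s])).
    by apply: prob_sub => [||w []//]; [exact: mE|exact: (measurable_history _ [set s])].
  rewrite prob_history lee_fin -mulrA ler_peMr ?invr_ge0 ?exprn_ge0 //.
  by rewrite ler_pdivlMr // mul1r.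
- rewrite (_ : E _ _ = set0) ?measure0 ?lee_fin.
    by rewrite !mulr_ge0 ?invr_ge0 ?exprn_ge0 // ltW.
  apply/seteqP; split => // w [ws [j]]; rewrite leqn0 => /eqP ->.
  by rewrite addn0 ws leNgt Uc.
- apply: (@le_trans _ _ (P [set w | history (size s) w = s])).
    by apply: prob_sub => [||w []//]; [exact: mE|exact: (measurable_history _ [set s])].
  rewrite prob_history lee_fin -mulrA ler_peMr ?invr_ge0 ?exprn_ge0 //.
  by rewrite ler_pdivlMr // mul1r.
(* Here [U s < c], so the crossing occurs at or below some child, with one draw fewer to go. *)
have sub : E N.+1 s `<=` \big[setU/set0]_(a < n) E N (a :: s).
  move=> w [ws [[|j] jN cj]]; first by move: cj; rewrite addn0 ws leNgt Uc.
  rewrite -bigcup_seq; exists (i (size s) w); first by rewrite /= mem_index_enum.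
  by split; [rewrite /= ws | exists j => //; move: cj; rewrite -addSnnS].
apply: le_trans (prob_sub _ _ sub) _; [exact: mE|exact: bigsetU_measurable|].
rewrite measure_bigsetU_ord //; last first.
  move=> a b _ _ [w [[/= wa _] [/= wb _]]]; move: wa; rewrite /= => -[<- _].
  by case: wb.
apply: (@le_trans _ _ (\sum_(a < n) (n%:R ^- (size s).+1 * U (a :: s) / c)%:E)%E).
  by apply: lee_sum => a _; exact: IH.
rewrite sumEFin lee_fin -mulr_suml -mulr_sumr ler_pM2r ?invr_gt0 //.
have n0 : (0 : R) < n%:R by rewrite ltr0n.
apply: le_trans (ler_wpM2l _ (Usup s)) _; first by rewrite invr_ge0 exprn_ge0.
by rewrite mulrA exprSr invfM mulfVK ?gt_eqF.
Qed.

(* Ville's inequality over an infinite horizon, with the level sent to infinity. *)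
Lemma ville_bounded (U : seq 'I_n -> R) :
  (forall s, 0 <= U s) -> tree_supermartingale U ->
  {ae P, forall w, exists M : R, forall k, U (history k w) <= M}.
Proof.
move=> U0 Usup.
pose F (m : nat) := \bigcup_k [set w | [set s | m.+1%:R <= U s] (history k w)].
have mF m : measurable (F m).
  by apply: bigcupT_measurable => k; exact: measurable_history.
have PF m : (P (F m) <= (U [::] / m.+1%:R)%:E)%E.
  pose G N := [set w | history 0 w = [::] /\
       exists2 j, (j <= N)%N & (m.+1%:R <= U (history (0 + j) w))%R].
  have GN N : G N = \bigcup_(j in [set j | (j <= N)%N])
      [set w | [set s | m.+1%:R <= U s] (history j w)].
    by apply/seteqP; split => w /= => [[_ []]|[]] j jN cj;
      [exists j|split => //; exists j].
  have mG N : measurable (G N).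
    by rewrite GN; apply: bigcup_measurable => j _; exact: measurable_history.
  have FG : F m = \bigcup_N G N.
    apply/seteqP; split => w.
      by move=> [k _ /= Uk]; exists k => //; split => //; exists k.
    by move=> [N _ [_ [j _ Uj]]]; exists j.
  have := @nondecreasing_cvg_mu _ _ _ P G mG.
  rewrite -FG => /(_ (mF m)) cvgG.
  have {}cvgG : P \o G @ \oo --> P (F m).
    apply: cvgG => N N' NN'; apply/subsetPset => w [h [j jN Uj]].
    by split => //; exists j => //; exact: leq_trans NN'.
  rewrite -(cvg_lim _ cvgG) //; apply: lime_le; first by apply/cvg_ex; exists (P (F m)).
  apply: nearW => N; apply: le_trans (@ville_finite U m.+1%:R N [::] U0 Usup _) _ => //.
  by rewrite expr0 invr1 mul1r.
exists (\bigcap_m F m); split.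
- exact: bigcapT_measurable.
- apply/eqP; rewrite eq_le measure_ge0 andbT; apply/lee_addgt0Pr => e e0.
  rewrite add0e.
  (* Adding 1 guards against [U [::] = 0]. *)
  have e1 : 0 < e / (U [::] + 1) by rewrite divr_gt0 // ltr_wpDl.
  have [m _ hm] := near_infty_natSinv_lt (PosNum e1).
  have := hm m (leqnn m); rewrite /= ltr_pdivlMr ?ltr_wpDl // => hm'.
  apply: (@le_trans _ _ (P (F m))).
    by apply: prob_sub => //; [exact: bigcapT_measurable|exact: bigcap_inf].
  apply: le_trans (PF m) _; rewrite lee_fin.
  rewrite mulrDr mulr1 in hm'; rewrite mulrC ltW // (le_lt_trans _ hm') // lerDl.
  by rewrite invr_ge0.
move=> w /= nM m _; apply: contrapT => nF; apply: nM; exists m.+1%:R => k.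
by rewrite leNgt; apply/negP => lt; apply: nF; exists k => //=; exact: ltW.
Qed.

(** Hysteresis: between the levels [a] and [b] the state is inherited from the shorter history. *)
Fixpoint holding (V : seq 'I_n -> R) (a b : R) (s : seq 'I_n) : bool :=
  (V s <= a) || (V s < b) && (if s is _ :: s' then holding V a b s' else false).

(* The capital, started at [a], of the gambler who buys one share at price at most
   [a] and sells it at price at least [b]. *)
Fixpoint capital (V : seq 'I_n -> R) (a b : R) (s : seq 'I_n) : R :=
  if s is _ :: s' then
    capital V a b s' + (if holding V a b s' then V s - V s' else 0)
  else a.

Fixpoint purchases (V : seq 'I_n -> R) (a b : R) (s : seq 'I_n) : nat :=
  if s is _ :: s' then
    (purchases V a b s' + (~~ holding V a b s' && holding V a b s))%N
  else holding V a b [::].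

(** * Doob's upcrossing argument as a trading strategy *)

Section Gambling.
Variables (V : seq 'I_n -> R) (a b : R).
Hypotheses (V_ge0 : forall s, 0 <= V s) (Vsup : tree_supermartingale V).
Hypotheses (a_gt0 : 0 < a) (ab : a < b).

Let hold := holding V a b.
Let cap := capital V a b.
Let buys := purchases V a b.

Let hold_cons x s : hold (x :: s) = (V (x :: s) <= a) || (V (x :: s) < b) && hold s.
Proof. by []. Qed.

Let buys_nil : buys [::] = hold [::] :> nat.
Proof. by []. Qed.

Let buys_cons x s : buys (x :: s) = (buys s + (~~ hold s && hold (x :: s)))%N.
Proof. by []. Qed.

Let cap_cons x s : cap (x :: s) = cap s + (if hold s then V (x :: s) - V s else 0).
Proof. by []. Qed.

Lemma purchases_gt0 s : hold s -> (0 < buys s)%N.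
Proof.
elim: s => [|x s IH] hs; first by rewrite buys_nil hs.
rewrite buys_cons hs andbT.
by case: (boolP (hold s)) => [/IH|_]; [rewrite addn0|rewrite addn1].
Qed.

(** Each completed round trip earns at least [b - a]. While a share is held, the latest purchase, at
    a price at most [a], is still open; hence the [- 1], and [V s] in place of [a]. *)
Lemma capital_ge s :
  (if hold s then V s + ((buys s)%:R - 1) * (b - a)
   else a + (buys s)%:R * (b - a)) <= cap s.
Proof.
elim: s => [|x s IH].
  case: ifP => h; rewrite buys_nil h; last by rewrite mul0r addr0.
  by move: h; rewrite /hold /= andbF orbF subrr mul0r addr0.
rewrite cap_cons buys_cons; move: IH; rewrite hold_cons.
case: (hold s) => IH; rewrite ?andbT ?andbF ?orbF /= ?addn0; last first.
  case: (leP (V (x :: s)) a) => Va /=; rewrite ?addn0 ?addr0 // addn1 -natr1; lra.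
case: ifPn => [_|]; first by lra.
by rewrite negb_or -!ltNge -leNgt => /andP[_ Vb]; lra.
Qed.

Lemma capital_ge0 s : 0 <= cap s.
Proof.
apply: le_trans (capital_ge s); have ba : 0 <= b - a by rewrite subr_ge0 ltW.
case: ifP => [/purchases_gt0 h|_].
  by rewrite addr_ge0 // mulr_ge0 // subr_ge0 ler1n.
by rewrite addr_ge0 ?mulr_ge0 // ltW.
Qed.

(** Whether a share is held is settled by [s], before the next draw, so the gain has nonpositive
    conditional mean. *)
Lemma capital_supermartingale : tree_supermartingale cap.
Proof.
move=> s; under eq_bigr do rewrite cap_cons.
rewrite big_split /= sumr_const card_ord -[cap s *+ n]mulr_natl.
rewrite gerDl; case: (hold s); last by rewrite big1.
by rewrite sumrB sumr_const card_ord -[V s *+ n]mulr_natl subr_le0; exact: Vsup.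
Qed.

Lemma purchases_bound s : (buys s)%:R * (b - a) <= cap s + (b - a).
Proof.
by have := capital_ge s; have := V_ge0 s; have := a_gt0; have := ab; case: ifP => _; lra.
Qed.

Lemma purchases_incr w k l : (k <= l)%N ->
  (buys (history k w) + (~~ hold (history k w) && hold (history l w)) <=
   buys (history l w))%N.
Proof.
elim: l => [|l IH].
  by rewrite leqn0 => /eqP ->; rewrite andNb addn0.
rewrite leq_eqVlt => /predU1P[->|/IH]; first by rewrite andNb addn0.
rewrite [history l.+1 w]/= buys_cons.
by case: (hold (history k w)); case: (hold (history l w));
  case: (hold (_ :: _)); lia.
Qed.

(** The visits force arbitrarily many purchases, whereas [purchases_bound] limits their number in
    terms of [M]. *)
Lemma capital_bounded_no_oscillation w (M : R) :
  (forall k, cap (history k w) <= M) ->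
  (forall k, exists2 l, (k <= l)%N & V (history l w) <= a) ->
  (forall k, exists2 l, (k <= l)%N & b <= V (history l w)) -> False.
Proof.
move=> capM low high.
have many m : exists k, (m <= buys (history k w))%N.
  elim: m => [|m [k mk]]; first by exists 0%N.
  (* Nothing is held at [l], where the price is at least [b]; holding again at the later [l'] takes
     a new purchase. *)
  have [l kl Vl] := high k; have [l' ll' Vl'] := low l.
  exists l'; apply: leq_trans (purchases_incr w ll').
  have -> : hold (history l' w) by case: (l') Vl' => [|?] /= Vl'; rewrite /hold /= Vl'.
  have -> : hold (history l w) = false.
    have la : (V (history l w) <= a) = false.
      by apply/negbTE; rewrite -ltNge; apply: lt_le_trans Vl.
    have lb : (V (history l w) < b) = false by apply/negbTE; rewrite -leNgt.
    by move: la lb; case: (l) => [|?] /= la lb; rewrite /hold /= la lb.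
  by rewrite addn1 ltnS (leq_trans mk) // (leq_trans _ (purchases_incr w kl)) ?leq_addr.
have ba : 0 < b - a by rewrite subr_gt0.
have M0 : 0 <= M by apply: le_trans (capM 0%N); exact: capital_ge0.
have q0 : 0 <= (M + (b - a)) / (b - a).
  apply: divr_ge0; last exact: ltW.
  by apply: addr_ge0 => //; exact: ltW.
have [k] := many (Num.bound ((M + (b - a)) / (b - a))).
rewrite -(ler_nat R); apply/negP; rewrite -ltNge.
apply: le_lt_trans (archi_boundP q0).
rewrite ler_pdivlMr //.
by apply: le_trans (purchases_bound _) _; rewrite lerD2r.
Qed.

End Gambling.

Lemma ae_forall_countable (T : countType) (Q : T -> Omega -> Prop) :
  (forall t, {ae P, forall w, Q t w}) -> {ae P, forall w, forall t, Q t w}.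
Proof.
move=> QP.
have /ae_foralln : forall m, {ae P, forall w,
    if unpickle m is Some t then Q t w else True}.
  by move=> m; case: unpickle => [t|]; [exact: QP|exact: filterE].
by apply: filterS => w h t; have := h (pickle t); rewrite pickleK.
Qed.

Lemma supermartingale_cvg (V : seq 'I_n -> R) :
  (forall s, 0 <= V s) -> tree_supermartingale V ->
  {ae P, forall w, exists l : R, (fun k => V (history k w)) @ \oo --> l}.
Proof.
move=> V0 Vsup.
have bounded := ville_bounded V0 Vsup.
have /ae_forall_countable caps : forall pq : rat * rat, {ae P, forall w,
    0 < ratr pq.1 :> R -> ratr pq.1 < ratr pq.2 :> R ->
    exists M : R, forall k, capital V (ratr pq.1) (ratr pq.2) (history k w) <= M}.
  move=> [p q] /=.
  have [p0|] := boolP (0 < ratr p :> R); last by move=> _; exact: filterE.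
  have [pq|] := boolP (ratr p < ratr q :> R); last by move=> _; exact: filterE.
  have := @ville_bounded (capital V (ratr p) (ratr q)).
  move=> /(_ (capital_ge0 V0 p0 pq) (capital_supermartingale _ _ Vsup)).
  by apply: filterS => w h _ _.
apply: filterS2 bounded caps => w [M VM] caps.
apply: (@cvg_of_no_oscillation _ _ M) => // p q p0 pq low high.
have [M' capM] := caps (p, q) p0 pq.
exact: (capital_bounded_no_oscillation V0 p0 pq capM).
Qed.

End HistoryTree.

(** * Opial's lemma and measurability of weak limits *)

Section Opial.
Variables (R : realType) (H : completeNormedModType R) (ip : H -> H -> R).
Hypothesis hip : is_inner_product ip.

(** If a preimage is not in [F], its complement is compatible with [F], and an ultrafilter
    containing both contradicts convergence. *)
Lemma cvg_ultra T (S : topologicalType) (F : set_system T) (f : T -> S) (a : S) :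
  Filter F -> (forall U, UltraFilter U -> F `<=` U -> f @ U --> a) -> f @ F --> a.
Proof.
move=> FF h B aB; apply: contrapT => nFB.
have WP : ProperFilter (within (~` (f @^-1` B)) F).
  apply: Build_ProperFilter => W0.
  by apply: nFB; apply: (@filterS _ F _ _ _ _ W0) => t; apply: contrapT.
have [U [UU WU]] := ultraFilterLemma WP.
have UB : U (f @^-1` B).
  by apply: h aB => // C FC; apply: WU; apply: filterS FC => t Ct _.
have UnB : U (~` (f @^-1` B)) by apply: WU; exact: nearW.
have PU := @ultra_proper _ _ UU.
have := @filterI _ U (@filter_filter _ _ PU) _ _ UB UnB.
by rewrite setICr => /filter_not_empty.
Qed.

(** Two ultrafilter limits [a], [a0] lie in [Z], so [|x k - a|] and [|x k - a0|] converge, hence so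
    does [ip (x k) (a - a0)]. Its limits along the two ultrafilters agree, which gives
    [|a - a0|^2 = 0]. *)
Lemma opial (x : nat -> H) (Z : set H) (M : R) :
  (forall k, `|x k| <= M) ->
  (forall z, Z z -> exists l : R, (fun k => `|x k - z|) @ \oo --> l) ->
  (forall (U : set_system nat) a, UltraFilter U -> \oo `<=` U ->
     (forall y, (fun k => ip (x k) y) @ U --> ip a y) -> Z a) ->
  exists a, Z a /\ weak_cvg ip x a.
Proof.
move=> xM xZ clus.
have [U0 [UU0 U0oo]] := @ultraFilterLemma nat \oo _.
have [a0 ha0] := bounded_weak_ultra_cvg hip UU0 xM.
have Za0 := clus _ _ UU0 U0oo ha0.
exists a0; split => // y; apply: cvg_ultra => U UU Uoo.
have [a ha] := bounded_weak_ultra_cvg hip UU xM.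
suff <- : a = a0 by exact: ha.
have [l hl] := xZ _ (clus _ _ UU Uoo ha); have [l0 hl0] := xZ _ Za0.
have hc : (fun k => ip (x k) (a - a0)) @ \oo -->
    2^-1 * (l0 * l0 - l * l - (ip a0 a0 - ip a a)).
  have -> : (fun k => ip (x k) (a - a0)) = (fun k => 2^-1 *
      (`|x k - a0| * `|x k - a0| - `|x k - a| * `|x k - a| - (ip a0 a0 - ip a a))).
    apply/funext => k; rewrite -!expr2 -!(ipxx hip) !(ipE hip).
    by rewrite (ipC hip a (x k)) (ipC hip a0 (x k)); field.
  apply: cvgM; first exact: cvg_cst.
  by apply: cvgB; [apply: cvgB; apply: cvgM|exact: cvg_cst].
have e := cvg_unique (@Rhausdorff R) (ha (a - a0)) (fun B hB => Uoo _ (hc B hB)).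
have e0 := cvg_unique (@Rhausdorff R) (ha0 (a - a0)) (fun B hB => U0oo _ (hc B hB)).
apply/eqP; rewrite -subr_eq0; apply/eqP/(ip_eq0 hip).
by rewrite (ipDl hip) (ipNl hip) e e0 subrr.
Qed.

(** The distances [|x k - z|] are 1-Lipschitz in [z] uniformly in [k], so the Cauchy property
    extends from the family [zs] to all of [Z]. *)
Lemma cvg_norm_dense (x : nat -> H) (Z : set H) (I : Type) (zs : I -> H) :
  (forall z e, Z z -> 0 < e -> exists t, `|z - zs t| < e) ->
  (forall t, exists l : R, (fun k => `|x k - zs t|) @ \oo --> l) ->
  forall z, Z z -> exists l : R, (fun k => `|x k - z|) @ \oo --> l.
Proof.
move=> dense xzs z Zz; apply/cvg_ex; apply/cauchy_cvgP/cauchy_exP => e e0.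
have e2 : 0 < e / 2 by rewrite divr_gt0.
have [t zt] := dense _ _ Zz e2; have [l hl] := xzs t; exists l.
have /cvgrPdist_lt/(_ _ e2) := hl; apply: filterS => k /= hk.
rewrite -ball_normE /=.
have -> : l - `|x k - z| = (l - `|x k - zs t|) + (`|x k - zs t| - `|x k - z|).
  by rewrite addrA subrK.
rewrite (le_lt_trans (ler_normD _ _)) // [ltRHS]splitr ltrD //.
apply: le_lt_trans (ler_dist_dist _ _) _.
by rewrite opprB addrC addrA subrK.
Qed.

Lemma dense_sequence : separable_space H ->
  exists ds : nat -> H, forall x e, 0 < e -> exists j, `|x - ds j| < e.
Proof.
move=> [D [cD clD]].
have near_D x e : 0 < e -> exists2 y, D y & `|x - y| < e.
  move=> e0; have : closure D x by rewrite clD.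
  move=> /(_ _ (nbhsx_ballx x e e0)) [y [Dy]]; rewrite -ball_normE /= => xy.
  by exists y.
have /countable_injP[f injf] := cD.
exists (fun j => xget 0 [set y | D y /\ f y = j]) => x e e0.
have [y Dy xy] := near_D x e e0; exists (f y).
have [Dy' fy'] : [set y' | D y' /\ f y' = f y] (xget 0 [set y' | D y' /\ f y' = f y]).
  by apply: xgetPex; exists y.
by rewrite (injf _ y _ _ fy') // inE.
Qed.

(* Each index is sent to a point of [Z] near the corresponding point of a dense
   sequence, if there is one. *)
Lemma dense_in_subset (Z : set H) (z0 : H) : separable_space H -> Z z0 ->
  exists zs : nat * nat -> H, (forall t, Z (zs t)) /\
    forall z e, Z z -> 0 < e -> exists t, `|z - zs t| < e.
Proof.
move=> /dense_sequence[ds dsP] Zz0.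
pose near_ds (t : nat * nat) := [set z | Z z /\ `|z - ds t.1| < t.2.+1%:R^-1].
pose zs t := xget z0 (near_ds t).
exists zs; split=> [t|z e Zz e0]; first by rewrite /zs; case: xgetP => [z _ []|].
have e2 : 0 < e / 2 by rewrite divr_gt0.
have [m _ hm] := near_infty_natSinv_lt (PosNum e2).
have m0 : (0 : R) < m.+1%:R^-1 by rewrite invr_gt0.
have [j zj] := dsP z _ m0; exists (j, m).
have [_ h] : near_ds (j, m) (zs (j, m)) by apply: xgetPex; exists z.
have {}hm := hm m (leqnn m).
have -> : z - zs (j, m) = (z - ds j) - (zs (j, m) - ds j).
  by rewrite opprB addrA subrK.
rewrite (le_lt_trans (ler_normB _ _)) // [ltRHS]splitr.
by rewrite ltrD // (lt_trans _ hm).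
Qed.

(** Turns a closed ball into a countable intersection of half-spaces. *)
Lemma norm_le_dense (ds : nat -> H) (v : H) (r : R) : 0 <= r ->
  (forall x e, 0 < e -> exists j, `|x - ds j| < e) ->
  (forall j, ip v (ds j) <= r * `|ds j|) -> `|v| <= r.
Proof.
move=> r0 dsP h; have [->|v0] := eqVneq v 0; first by rewrite normr0.
have nv : 0 < `|v| by rewrite normr_gt0.
rewrite leNgt; apply/negP => rv.
(* The test at [u] near [v] yields [|v| (|v| - r) <= (|v| + r) |v - u|], which this radius rules
   out. *)
have e0 : 0 < `|v| * (`|v| - r) / (`|v| + r).
  by rewrite divr_gt0 ?mulr_gt0 ?subr_gt0 ?ltr_wpDr.
have [j vj] := dsP v _ e0; set u := ds j in vj.
have := vj; rewrite ltr_pdivlMr ?ltr_wpDr // => vj'.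
have h1 := ip_le hip v (v - u); have h2 := h j; rewrite -/u in h2.
have h3 : `|u| <= `|v| + `|v - u|.
  by rewrite -[u in leLHS](subKr v) (le_trans (ler_normB _ _)).
have := ler_wpM2l r0 h3.
by move: h1; rewrite (ipDr hip) (ipNr hip) (ipxx hip); nra.
Qed.

(** Off [N] the pairings [ip (xs w) y] are limits of measurable functions. An open set is a
    countable union of closed balls, each cut out by countably many such pairings. *)
Lemma borel_measurable_weak_limit d (Omega : measurableType d) (N : set Omega)
    (x : nat -> Omega -> H) (xs : Omega -> H) (z0 : H) :
  separable_space H -> measurable N ->
  (forall k y, measurable_fun setT (fun w => ip (x k w) y)) ->
  (forall w, N w -> xs w = z0) ->
  (forall w, ~ N w -> weak_cvg ip (fun k => x k w) (xs w)) ->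
  borel_measurable_map xs.
Proof.
move=> /dense_sequence[ds dsP] mN mx xsN xsC U oU.
have mC : measurable (~` N) by exact: measurableC.
have mlim y c : measurable (~` N `&` [set w | ip (xs w) y <= c]).
  have mf : measurable_fun (~` N) (fun w => ip (xs w) y).
    apply: (measurable_fun_cvg (h := fun k w => ip (x k w) y)).
      by move=> m; apply: measurable_funS (mx m y).
    by move=> w Nw; exact: xsC.
  have := mf mC `]-oo, c]%classic (measurable_itv _).
  by congr (measurable _); apply/seteqP; split => w /= [Nw]; rewrite in_itv /=.
pose good (jm : nat * nat) := forall y, `|y - ds jm.1| <= jm.2.+1%:R^-1 -> U y.
have UE y : U y <-> exists2 jm, good jm & `|y - ds jm.1| <= jm.2.+1%:R^-1.
  split=> [Uy|[jm gjm]]; last exact: gjm.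
  have /nbhs_ballP[e /= e0 eU] := open_nbhs_nbhs (conj oU Uy).
  have e2 : 0 < e / 2 by rewrite divr_gt0.
  have [m _ hm] := near_infty_natSinv_lt (PosNum e2).
  have m0 : (0 : R) < m.+1%:R^-1 by rewrite invr_gt0.
  have [j yj] := dsP y _ m0; exists (j, m) => /=; last exact: ltW.
  move=> y' /= y'j; apply: eU; rewrite -ball_normE /=.
  have {}hm := hm m (leqnn m).
  have -> : y - y' = (y - ds j) - (y' - ds j) by rewrite opprB addrA subrK.
  rewrite (le_lt_trans (ler_normB _ _)) // [ltRHS]splitr.
  by rewrite ltrD // ?(lt_trans yj) ?(le_lt_trans y'j).
have -> : xs @^-1` U = (N `&` [set w | U (xs w)]) `|`
   \bigcup_(jm in good) \bigcap_l (~` N `&` [set w | ip (xs w) (ds l) <=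
      jm.2.+1%:R^-1 * `|ds l| + ip (ds jm.1) (ds l)]).
  apply/seteqP; split=> [w /= Uw|w /=].
    have [Nw|Nw] := pselect (N w); [by left|right].
    have [jm gjm le_jm] := (UE _).1 Uw; exists jm => // l _; split => //=.
    rewrite -lerBlDr -(ipNl hip) -(ipDl hip) (le_trans (ip_le hip _ _)) //.
    exact: ler_wpM2r.
  move=> [[]//|[jm gjm h]]; apply/UE; exists jm => //.
  apply: (norm_le_dense _ dsP); first by rewrite invr_ge0.
  by move=> l; have [_ /=] := h l I; rewrite (ipDl hip) (ipNl hip) lerBlDr.
apply: measurableU.
  have [Uz|Uz] := pselect (U z0).
    rewrite (_ : _ `&` _ = N) //; apply/seteqP; split => w /=; first by case.
    by move=> Nw; split => //; rewrite xsN.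
  rewrite (_ : _ `&` _ = set0) //; apply/seteqP; split => w //= [Nw].
  by rewrite xsN.
rewrite bigcup_mkcond; apply: countable_bigcupT_measurable => // jm.
by case: ifP => // _; apply: bigcapT_measurable => l; exact: mlim.
Qed.

End Opial.

(** * The stochastic forward-reflected-backward iteration *)

Section Iteration.
Context (R : realType) (H : completeNormedModType R) (ip : H -> H -> R).
Hypothesis hip : is_inner_product ip.
Context (n : nat) (A : H -> set H) (B : H -> H) (Bs : 'I_n -> H -> H).
Context (L lam : R) (x0 xm1 : H).
Hypotheses (n_gt0 : (0 < n)%N) (Am : maximally_monotone ip A)
  (Bm : monotone_fun ip B)
  (BE : forall z, B z = n%:R^-1 *: \sum_(j < n) Bs j z)
  (L_gt0 : 0 < L) (BsL : forall j, lipschitz_with L (Bs j))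
  (lam_gt0 : 0 < lam) (lam_lt : lam < (2 * L)^-1).

Lemma average_lipschitz : lipschitz_with L B.
Proof.
move=> x y; rewrite !BE -scalerBr -sumrB normrZ.
have n0 : (0 : R) < n%:R by rewrite ltr0n.
rewrite ger0_norm; last by rewrite invr_ge0 ltW.
rewrite ler_pdivrMl //.
apply: le_trans (ler_norm_sum _ _ _) _.
apply: (le_trans (ler_sum _ (fun j _ => BsL j x y))).
by rewrite sumr_const card_ord mulr_natl.
Qed.

Lemma step_lt : lam * L < 2^-1.
Proof.
rewrite -ltr_pdivlMr //; apply: lt_le_trans lam_lt _.
by rewrite invfM.
Qed.

Definition forb_step (a : 'I_n) (x xp : H) : H :=
  resolvent A lam (x - lam *: B x - lam *: (Bs a x - Bs a xp)).

(* The current and the previous iterate after the draws [s], latest first. *)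
Fixpoint iterates (s : seq 'I_n) : H * H :=
  if s is a :: s' then
    (forb_step a (iterates s').1 (iterates s').2, (iterates s').1)
  else (x0, xm1).

Definition lyapunov (z : H) (s : seq 'I_n) : R :=
  let (x, xp) := iterates s in
  ip (x - z) (x - z) + 2 * lam * ip (x - z) (B xp - B x) + 2^-1 * ip (x - xp) (x - xp).

(** Cauchy-Schwarz followed by [|u| c <= (|u|^2 + c^2) / 2]. *)
Lemma ip_le_half (u v : H) (c : R) : 0 <= c -> `|v| <= L * c ->
  - ip u v <= L / 2 * (ip u u + c ^+ 2).
Proof.
move=> c0 vc; rewrite -(ipNr hip) (le_trans (ip_le hip _ _)) // normrN (ipxx hip).
apply: le_trans (ler_wpM2l (normr_ge0 _) vc) _.
have := mulr_ge0 (ltW L_gt0) (sqr_ge0 (`|u| - c)); lra.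
Qed.

Lemma lyapunov_ge z s :
  2^-1 * ip ((iterates s).1 - z) ((iterates s).1 - z) <= lyapunov z s.
Proof.
rewrite /lyapunov; case: (iterates s) => x xp /=.
have := ip_le_half (x - z) (normr_ge0 (x - xp)) _.
move=> /(_ (B xp - B x)); rewrite distrC => /(_ (average_lipschitz _ _)) h.
have := ler_wpM2l (ltW lam_gt0) h; rewrite -(ipxx hip).
have p1 := ip_ge0 hip (x - z); have p2 := ip_ge0 hip (x - xp).
have := ler_wpM2r (addr_ge0 p1 p2) (ltW step_lt); lra.
Qed.

(** The sampling error is paired with [x - z], which is fixed before the draw [a], so that it can
    average to zero over the children. *)
Lemma lyapunov_step z s a : zeros_sum A B z ->
  let (x, xp) := iterates s in
  lyapunov z (a :: s) <= lyapunov z s - (2^-1 - lam * L) * ip (x - xp) (x - xp)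
    - 2 * lam * ip (x - z) ((Bs a x - Bs a xp) - (B x - B xp)).
Proof.
move=> Az; rewrite /lyapunov /=; case: (iterates s) => x xp /=.
have [b [Ab eb]] := resolvent_spec hip
  (x - lam *: B x - lam *: (Bs a x - Bs a xp)) Am lam_gt0.
rewrite /forb_step; set x' := resolvent _ _ _ in Ab eb *.
(* Monotonicity of [A + B] between the new iterate and the zero [z]. *)
have h1 : 0 <= lam * ip (x' - z) (b + B x').
  rewrite mulr_ge0 ?(ltW lam_gt0) //.
  have := (proj1 Am) _ _ _ _ Ab Az; have := Bm x' z.
  by rewrite !(ipE hip); lra.
have elb : lam *: b = x - lam *: B x - lam *: (Bs a x - Bs a xp) - x'.
  by rewrite eb [RHS]addrAC subrr add0r.
move: h1; rewrite -(ipZr hip) scalerDr elb => h1.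
(* Writing [x' - z] as [(x' - x) + (x - z)], only the part depending on the draw is estimated. *)
have h2 : - ip (x' - x) (Bs a x - Bs a xp) <=
    L / 2 * (ip (x' - x) (x' - x) + ip (x - xp) (x - xp)).
  by rewrite (ipxx hip (x - xp)); exact: (ip_le_half _ (normr_ge0 _) (BsL _ _ _)).
have {}h2 := ler_wpM2l (ltW lam_gt0) h2.
have h3 : 0 <= (2^-1 - lam * L) * ip (x - x') (x - x').
  by rewrite mulr_ge0 ?(ip_ge0 hip) // subr_ge0 ltW // step_lt.
move: h1 h2 h3; rewrite !(ipE hip).
rewrite (ipC hip x x') (ipC hip z x') (ipC hip z x) (ipC hip xp x).
lra.
Qed.

Lemma lyapunov_average z s : zeros_sum A B z ->
  let (x, xp) := iterates s in
  \sum_(a < n) lyapunov z (a :: s) <=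
    n%:R * (lyapunov z s - (2^-1 - lam * L) * ip (x - xp) (x - xp)).
Proof.
move=> Az; have h a := lyapunov_step s a Az.
case: (iterates s) h => x xp h.
apply: (le_trans (ler_sum _ (fun a _ => h a))).
(* Since [B] is the average of the [Bs], the sampling errors cancel. *)
suff e : \sum_(a < n) ip (x - z) (Bs a x - Bs a xp - (B x - B xp)) = 0.
  by rewrite sumrB -mulr_sumr e mulr0 subr0 sumr_const card_ord mulr_natl.
have n0 : (n%:R : R) != 0 by rewrite pnatr_eq0 -lt0n.
have sumB y : \sum_(a < n) Bs a y = n%:R *: B y.
  by rewrite BE scalerA mulfV // scale1r.
have ip_sum (F : 'I_n -> H) u : \sum_(a < n) ip u (F a) = ip u (\sum_(a < n) F a).
  by elim/big_ind2 : _ => [|u1 r1 u2 r2 -> ->|]; rewrite ?(ip0r hip) ?(ipDr hip).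
rewrite ip_sum !sumrB !sumB !sumr_const card_ord !scaler_nat.
by rewrite subrr (ip0r hip).
Qed.

Definition last_step (s : seq 'I_n) : R :=
  `|(iterates s).1 - (iterates s).2|.

(** Lags by one draw: the squared step at a node is counted only from its children on, in line with
    the decrease in [lyapunov_average]. *)
Fixpoint travelled (s : seq 'I_n) : R :=
  if s is _ :: s' then travelled s' + last_step s' ^+ 2 else 0.

Lemma travelled_ge0 s : 0 <= travelled s.
Proof. by elim: s => //= _ s IH; rewrite addr_ge0 ?exprn_ge0 /last_step. Qed.

Lemma lyapunov_ge0 z s : 0 <= lyapunov z s.
Proof. by apply: le_trans (lyapunov_ge z s); rewrite mulr_ge0 ?(ip_ge0 hip). Qed.

Lemma gap_gt0 : 0 < 2^-1 - lam * L.
Proof. by rewrite subr_gt0 step_lt. Qed.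

Lemma lyapunov_supermartingale z : zeros_sum A B z ->
  tree_supermartingale (lyapunov z).
Proof.
move=> Az s; have := lyapunov_average s Az; case: (iterates s) => x xp.
move=> /le_trans; apply; rewrite ler_wpM2l // gerBl.
by rewrite mulr_ge0 ?(ip_ge0 hip) // ltW ?gap_gt0.
Qed.

Lemma energy_supermartingale z : zeros_sum A B z ->
  tree_supermartingale (fun s => lyapunov z s + (2^-1 - lam * L) * travelled s).
Proof.
move=> Az s; have := lyapunov_average s Az.
have -> : \sum_(a < n) (lyapunov z (a :: s) + (2^-1 - lam * L) * travelled (a :: s)) =
    \sum_(a < n) lyapunov z (a :: s) +
    n%:R * ((2^-1 - lam * L) * (travelled s + last_step s ^+ 2)).
  rewrite big_split; congr (_ + _).
  by rewrite /= sumr_const card_ord mulr_natl.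
by rewrite /last_step -(ipxx hip); case: (iterates s) => x xp /=; lra.
Qed.

(** * Limits along one sample path *)

Section Path.
Context (d : measure_display) (Omega : measurableType d).
Variables (i : nat -> Omega -> 'I_n) (w : Omega).
Let h k := history i k w.
Let X k := (iterates (h k)).1.

(** The squared steps are the increments of a bounded nondecreasing sequence. *)
Lemma last_step_cvg0 (M : R) : (forall k, travelled (h k) <= M) ->
  (fun k => last_step (h k)) @ \oo --> (0 : R).
Proof.
move=> tM.
have /cvg_ex[l tl] : cvg ((fun k => travelled (h k)) @ \oo).
  apply: nondecreasing_is_cvgn; last by exists M => _ [k _ <-].
  by apply/nondecreasing_seqP => k; rewrite /h /= lerDl exprn_ge0 /last_step.
have sq : (fun k => last_step (h k) ^+ 2) @ \oo --> (0 : R).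
  have -> : (fun k => last_step (h k) ^+ 2) =
      (fun k => travelled (h k.+1) - travelled (h k)).
    by apply/funext => k; rewrite /h /= addrC addKr.
  rewrite -(subrr l); apply: cvgB => //.
  by rewrite (cvg_shiftS (fun k => travelled (h k))).
have -> : (fun k => last_step (h k)) = (fun k => Num.sqrt (last_step (h k) ^+ 2)).
  by apply/funext => k; rewrite sqrtr_sqr ger0_norm /last_step.
rewrite -(sqrtr0 R); exact: (continuous_cvg _ (@sqrt_continuous R 0) sq).
Qed.

Hypothesis steps : (fun k => last_step (h k)) @ \oo --> (0 : R).
Variables (M : R).
Hypothesis XM : forall k, `|X k| <= M.

(** With bounded iterates and vanishing steps, [lyapunov] and the squared distance differ by a null
    sequence. *)
Lemma dist_cvg z l : (fun k => lyapunov z (h k)) @ \oo --> (l : R) ->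
  exists l' : R, (fun k => `|X k - z|) @ \oo --> l'.
Proof.
move=> Vl; exists (Num.sqrt l).
have cross : (fun k => ip (X k - z) (B (iterates (h k)).2 - B (X k))) @ \oo --> (0 : R).
  apply/norm_cvg0P.
  apply: (@squeeze_cvgr _ _ _ _ (cst 0)
            (fun k => (M + `|z|) * (L * last_step (h k)))).
  - apply: nearW => k; rewrite normr_ge0 /= (le_trans (normr_ip_le hip _ _)) //.
    apply: ler_pM => //; first by rewrite (le_trans (ler_normB _ _)) ?lerD2r.
    by rewrite /last_step [X in L * X]distrC; exact: average_lipschitz.
  - exact: cvg_cst.
  rewrite -(mulr0 (M + `|z|)) -(mulr0 L).
  by apply: cvgM; [exact: cvg_cst|apply: cvgM => //; exact: cvg_cst].
have sq : (fun k => `|X k - z| ^+ 2) @ \oo --> l.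
  have -> : (fun k => `|X k - z| ^+ 2) = (fun k => lyapunov z (h k)
      - 2 * lam * ip (X k - z) (B (iterates (h k)).2 - B (X k))
      - 2^-1 * (last_step (h k) * last_step (h k))).
    apply/funext => k; rewrite /lyapunov /last_step -expr2 -!(ipxx hip) /X.
    by case: (iterates (h k)) => x xp /=; ring.
  have -> : l = l - 2 * lam * 0 - 2^-1 * (0 * 0) by rewrite !mulr0 !subr0.
  by apply: cvgB; [apply: cvgB => //; apply: cvgM|apply: cvgM; [|apply: cvgM]] => //;
    exact: cvg_cst.
have -> : (fun k => `|X k - z|) = (fun k => Num.sqrt (`|X k - z| ^+ 2)).
  by apply/funext => k; rewrite sqrtr_sqr ger0_norm.
exact: (continuous_cvg _ (@sqrt_continuous R l) sq).
Qed.

(** Monotonicity of [A + B] between [X k.+1] and a graph point leaves, up to errors vanishing with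
    the steps, a pairing of [X k] with a fixed vector, which passes to the weak limit. *)
Lemma weak_cluster_zero (U : set_system nat) a : UltraFilter U -> \oo `<=` U ->
  (forall y, (fun k => ip (X k) y) @ U --> ip a y) -> zeros_sum A B a.
Proof.
move=> UU Uoo Xa.
apply: (zero_of_monotone_relation hip Am L_gt0 average_lipschitz) => y v Ayv.
pose dd k := last_step (h k).
(* Bounds the residual [r] paired with [X k.+1 - y], plus the cost of replacing [X k.+1] by [X k] in
   the linear term. *)
pose g k := (M + `|y|) * (dd k.+1 + lam * (L * dd k.+1 + L * dd k))
  + lam * (dd k.+1 * `|- B y - v|).
have ddS : (fun k => dd k.+1) @ \oo --> (0 : R) by rewrite (cvg_shiftS dd).
have g0 : g @ \oo --> (0 : R).
  pose c := (M + `|y|) * (1 + lam * L) + lam * `|- B y - v|.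
  pose c' := (M + `|y|) * lam * L.
  have -> : g = (fun k => c * dd k.+1 + c' * dd k).
    by apply/funext => k; rewrite /g /c /c'; ring.
  have -> : (0 : R) = c * 0 + c' * 0 by rewrite !mulr0 addr0.
  by apply: cvgD; apply: cvgM => //; exact: cvg_cst.
have lim : (fun k => g k + lam * (ip (X k) (- B y - v) - ip y (- B y - v))) @ U -->
    0 + lam * (ip a (- B y - v) - ip y (- B y - v)).
  apply: cvgD; first by move=> S /g0; exact: Uoo.
  by apply: cvgM; [exact: cvg_cst|apply: cvgB => //; exact: cvg_cst].
rewrite (ipDl hip) (ipNl hip) -(pmulr_rge0 _ lam_gt0) -[leRHS]add0r.
apply: (cvgr_to_ge lim); apply: nearW => k.
have := resolvent_spec hip (X k - lam *: B (X k) -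
  lam *: (Bs (i k w) (X k) - Bs (i k w) (iterates (h k)).2)) Am lam_gt0.
rewrite -[resolvent _ _ _]/(X k.+1) => -[b [Ab eb]].
have ddSk : dd k.+1 = `|X k.+1 - X k| by [].
have ddk : dd k = `|X k - (iterates (h k)).2| by [].
set xp := (iterates _).2 in eb ddk.
set D := Bs _ _ - _ in eb.
have DL : `|D| <= L * dd k by rewrite ddk; exact: BsL.
clearbody D.
have mono : 0 <= lam * ip (X k.+1 - y) ((b + B (X k.+1)) + (- B y - v)).
  rewrite mulr_ge0 ?(ltW lam_gt0) //.
  have := (proj1 Am) _ _ _ _ Ab Ayv; have := Bm (X k.+1) y.
  by rewrite !(ipE hip); lra.
pose r := (X k - X k.+1) - lam *: ((B (X k) - B (X k.+1)) + D).
have er : lam *: (b + B (X k.+1)) = r.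
  have elb : lam *: b = X k - lam *: B (X k) - lam *: D - X k.+1.
    by rewrite eb [RHS]addrAC subrr add0r.
  rewrite /r scalerDr elb !scalerDr !scalerN !opprD opprK !addrA.
  by rewrite [LHS](ACl (1*4*2*5*3))%AC.
have rb : `|r| <= dd k.+1 + lam * (L * dd k.+1 + L * dd k).
  rewrite (le_trans (ler_normB _ _)) // distrC -ddSk lerD2l normrZ.
  rewrite (ger0_norm (ltW lam_gt0)).
  rewrite ler_pM2l // (le_trans (ler_normD _ _)) // lerD //.
  by rewrite distrC ddSk average_lipschitz.
have Xy : `|X k.+1 - y| <= M + `|y|.
  by rewrite (le_trans (ler_normB _ _)) // lerD2r.
have t1 : ip (X k.+1 - y) r <= (M + `|y|) * (dd k.+1 + lam * (L * dd k.+1 + L * dd k)).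
  by rewrite (le_trans (ip_le hip _ _)) // ler_pM.
have t2 : lam * ip (X k.+1 - X k) (- B y - v) <= lam * (dd k.+1 * `|- B y - v|).
  by rewrite ler_pM2l // (ip_le hip).
move: mono; rewrite (ipDr hip) mulrDr -(ipZr hip) er => mono.
move: t2 mono; rewrite /g !(ipDl hip _ _ (- B y - v)) !(ipNl hip) => t2 mono.
by lra.
Qed.

End Path.

End Iteration.

Theorem theorem6p2 (R : realType) (H : completeNormedModType R)
  (ip : H -> H -> R)
  (d : measure_display) (Omega : measurableType d)
  (P : probability Omega R)
  (n : nat) (A : H -> set H) (B : H -> H) (Bs : 'I_n -> H -> H)
  (L lam : R) (x0 xm1 : H)
  (i : nat -> Omega -> 'I_n) (x : nat -> Omega -> H) :
  is_inner_product ip ->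
  separable_space H ->
  (0 < n)%N ->
  maximally_monotone ip A ->
  monotone_fun ip B ->
  (forall z, B z = n%:R^-1 *: \sum_(j < n) Bs j z) ->
  0 < L ->
  (forall j, lipschitz_with L (Bs j)) ->
  zeros_sum A B !=set0 ->
  0 < lam -> lam < (2 * L)^-1 ->
  (* i_0, i_1, ... are independent and uniformly distributed on 'I_n *)
  (forall k (a : 'I_n), measurable [set w | i k w = a]) ->
  (forall k (a : 'I_k -> 'I_n),
      P [set w | forall j : 'I_k, i j w = a j] = ((n%:R ^- k : R)%:E)) ->
  (* the iteration; x (-1) = xm1 *)
  (forall w, x 0 w = x0) ->
  (forall k w,
      let xprev := if k is k'.+1 then x k' w else xm1 in
      x k.+1 w = resolvent A lam
        (x k w - lam *: B (x k w)
           - lam *: (Bs (i k w) (x k w) - Bs (i k w) xprev))) ->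
  exists xs : Omega -> H,
    [/\ borel_measurable_map xs,
        (forall w, zeros_sum A B (xs w)) &
        {ae P, forall w, weak_cvg ip (fun k => x k w) (xs w)}].
Proof.
move=> hip sep n0 Am Bm BE L0 BsL [z0 Az0] lam0 lamlt mi ui x0E xE.
pose iter w k := iterates A B Bs lam x0 xm1 (history i k w).
have x_iter w k : x k w = (iter w k).1 /\
    (if k is k'.+1 then x k' w else xm1) = (iter w k).2.
  elim: k => [|k [IH1 IH2]]; first by rewrite x0E.
  split; last exact: IH1.
  by have := xE k w => /= ->; rewrite IH1 IH2.
have xE' w : (fun k => x k w) = (fun k => (iter w k).1).
  by apply/funext => k; have [] := x_iter w k.
have [zs [zsZ zs_dense]] := dense_in_subset sep Az0.
pose V z := lyapunov ip A B Bs lam x0 xm1 z.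
have V0 z s : 0 <= V z s by exact: (lyapunov_ge0 hip A x0 xm1 n0 BE L0 BsL lam0 lamlt).
have gap0 : 0 < 2^-1 - lam * L by exact: (gap_gt0 L0 lamlt).
(* The energy of a single zero bounds both the squared steps and the iterates. *)
have bounded := ville_bounded n0 mi ui
  (fun s => addr_ge0 (V0 z0 s) (mulr_ge0 (ltW gap0) (travelled_ge0 A B Bs lam x0 xm1 s)))
  (energy_supermartingale hip x0 xm1 n0 Am Bm BE L0 BsL lam0 lamlt Az0).
(* Null sets can be united only over countably many zeros, hence the dense family [zs]. *)
have converges : {ae P, forall w, forall t, exists l : R,
    (fun k => V (zs t) (history i k w)) @ \oo --> l}.
  apply: ae_forall_countable => t; apply: (supermartingale_cvg n0 mi ui) => //.
  exact: (lyapunov_supermartingale hip x0 xm1 n0 Am Bm BE L0 BsL lam0 lamlt (zsZ t)).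
have weak : {ae P, forall w, exists a, zeros_sum A B a /\ weak_cvg ip (fun k => x k w) a}.
  apply: filterS2 bounded converges => w [M WM] Vl; rewrite xE'.
  have tM k : travelled A B Bs lam x0 xm1 (history i k w) <= M / (2^-1 - lam * L).
    by rewrite ler_pdivlMr // mulrC; have := WM k; have := V0 z0 (history i k w); lra.
  have steps := last_step_cvg0 tM.
  have XM k : `|(iter w k).1| <= Num.sqrt (2 * M) + `|z0|.
    rewrite -[X in `|X|](subrK z0) (le_trans (ler_normD _ _)) // lerD2r.
    have -> : `|(iter w k).1 - z0| = Num.sqrt (`|(iter w k).1 - z0| ^+ 2).
      by rewrite sqrtr_sqr ger0_norm.
    apply: ler_wsqrtr; rewrite -(ipxx hip).
    have := lyapunov_ge hip A x0 xm1 n0 BE L0 BsL lam0 lamlt z0 (history i k w).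
    have := mulr_ge0 (ltW gap0) (travelled_ge0 A B Bs lam x0 xm1 (history i k w)).
    have := WM k.
    by rewrite -/(V z0 _) -/(iter w k); lra.
  apply: (opial hip XM) => [z Zz|U a UU Uoo Xa].
    apply: (cvg_norm_dense zs_dense) Zz => t; have [l hl] := Vl t.
      exact: (dist_cvg hip n0 BE BsL steps XM hl).
  exact: (weak_cluster_zero hip n0 Am Bm BE L0 BsL lam0 steps XM UU Uoo Xa).
have [N [mN PN0 subN]] := weak.
(* On the null set [N] a fixed zero is used, so that [xs] is zero-valued everywhere and
   measurable. *)
pose xs w := if w \in N then z0 else
  xget z0 [set a | zeros_sum A B a /\ weak_cvg ip (fun k => x k w) a].
have xsP w : ~ N w -> zeros_sum A B (xs w) /\ weak_cvg ip (fun k => x k w) (xs w).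
  move=> Nw; rewrite /xs memNset //.
  case: xgetP => [a _ //|none].
  by case: Nw; apply: subN => -[a Pa]; exact: none Pa.
exists xs; split.
- apply: (borel_measurable_weak_limit hip (x := x) (z0 := z0) sep mN).
  + move=> k y _ Y mY; rewrite setTI.
    have -> : (fun w => ip (x k w) y) @^-1` Y =
        [set w | [set s | Y (ip (iterates A B Bs lam x0 xm1 s).1 y)] (history i k w)].
      by apply/seteqP; split => w /=; rewrite (proj1 (x_iter w k)).
    exact: measurable_history.
  + by move=> w Nw; rewrite /xs mem_set.
  + by move=> w /xsP[].
- move=> w; have [Nw|/xsP[]//] := pselect (N w).
  by rewrite /xs mem_set.
- exists N; split => // w /= nw; apply: contrapT => /xsP[_ h]; exact: nw.
Qed.
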